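(* Let $G = K \rtimes_\varphi \langle t\rangle$ be a finitely generated group, where $K$ is abelian, $\langle t\rangle$ is infinite cyclic and $\varphi\in\mathrm{Aut}(K)$. Let $R$ be a finite symmetric subset of $K$ such that $S=\{(r,1),(0,t^{\pm1}) : r\in R\}$ generates $G$. Let $f$ be a non-negative real function with $f(r)\to\infty$, and let $$F(r)=\{g\in S'(r) : |[g]_G\cap S(r)|\le f(r)\}.$$ Then $c(F(r))=r^{O(f(r))}$, i.e. there is a constant $C$ such that $c(F(r))\le r^{C f(r)}$ for all sufficiently large $r$.
   Context: $K$ is written additively; elements of $G$ are pairs $(k,t^m)$ with $(k,t^m)(k',t^{m'})=(k+\varphi^m(k'),t^{m+m'})$. $|g|$ is word length with respect to $S$, $S(r)=\{g:|g|=r\}$. $[g]_G$ is the conjugacy class of $g$. $S'(r)$ is the set of $g\in S(r)$ with $|g|=\min\{|h|: h\in[g]_G\}$. For $A\subseteq G$, $c(A)$ is the number of distinct conjugacy classes meeting $A$. *)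

(* Defs.v *)
From mathcomp Require Import all_boot all_order all_algebra.
From mathcomp Require Import all_classical all_reals.
From mathcomp Require Import exp finmap.
Set Implicit Arguments. Unset Strict Implicit. Unset Printing Implicit Defensive.
Import Order.TTheory GRing.Theory Num.Theory.
Local Open Scope classical_set_scope.
Local Open Scope ring_scope.

(* The group G = K ⋊_phi <t>, elements (k, t^m) encoded as pairs (k, m) : K * int.
   phi : K -> K is an additive automorphism with inverse psi. *)
Section SemiDirect.
Variables (K : zmodType) (phi psi : K -> K).

Definition phiz (m : int) (k : K) : K :=
  match m with
  | Posz n => iter n phi k
  | Negz n => iter n.+1 psi k
  end.

Definition gmul (g h : K * int) : K * int := (g.1 + phiz g.2 h.1, g.2 + h.2).
Definition gone : K * int := (0, 0).
Definition ginv (g : K * int) : K * int := (- phiz (- g.2) g.1, - g.2).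

Definition gens (R : seq K) : set (K * int) :=
  [set g | (g.1 \in R /\ g.2 = 0) \/ g = (0, 1) \/ g = (0, -1)].

Definition eval_word (w : seq (K * int)) : K * int := foldr gmul gone w.

Definition has_word_len (R : seq K) (g : K * int) (n : nat) : Prop :=
  exists w : seq (K * int),
    size w = n /\ (forall s, s \in w -> gens R s) /\ eval_word w = g.

(* word length |g| w.r.t. S (the least n; 0 if g is not in the span, which
   does not happen under the generation hypothesis) *)
Definition wlen (R : seq K) (g : K * int) : nat :=
  match pselect (exists n, (fun n => `[< has_word_len R g n >]) n) with
  | left h => ex_minn h
  | right _ => 0%N
  end.

Definition sphere (R : seq K) (r : nat) : set (K * int) :=
  [set g | wlen R g = r].

Definition conj_class (g : K * int) : set (K * int) :=
  [set h | exists x, h = gmul (ginv x) (gmul g x)].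

Definition sphere' (R : seq K) (r : nat) : set (K * int) :=
  [set g | sphere R r g /\ (forall h, conj_class g h -> (wlen R g <= wlen R h)%N)].

Definition nclasses (A : set (K * int)) : nat :=
  (#|` fset_set [set conj_class g | g in A] |)%fset.

Definition Fset (Rl : realType) (R : seq K) (f : nat -> Rl) (r : nat) : set (K * int) :=
  [set g | sphere' R r g /\
           (((#|` fset_set (conj_class g `&` sphere R r)|)%fset)%:R <= f r)].

End SemiDirect.

(* Main.v *)
(* Write q0 for the floor of f r.  For g = (k, t^m) in F(r), the cyclic shifts of a
   geodesic word of g are conjugates of g of length r, so at most q0 of them are
   distinct.  If the word visits more than q0 heights, two shifts cut at heights
   differing by some 0 < q <= q0 coincide, and g commutes with an element
   (z, t^q) of length O(r); when m <> 0 this is automatic if the heights fit in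
   q0 levels, since g commutes with itself.  Otherwise g is conjugate to a sum
   of at most r monomials phi^h(rho) with h < q0 and rho in R, and there are
   r^O(q0) of those.

   In the commuting case, conjugating by K reduces z modulo phi^q - 1 to one of
   r^O(q0) elements w0.  Two elements (x, t^m) and (x', t^m) commuting with the
   same (w0, t^q) satisfy phi^q(x - x') = x - x'.  As K is a finitely generated
   Z[t, 1/t]-module, hence Noetherian, there are P and N such that with
   u = phi^P - 1 no nonzero phi-periodic element lies in u^N K.  So x is
   determined by its class modulo u^N K, and, u being nilpotent on K / u^N K,
   sums of r^O(1) monomials meet only r^O(1) of these classes. *)
Require Import Defs.
From mathcomp Require Import all_boot all_order all_algebra.
From mathcomp Require Import all_classical all_reals.
From mathcomp Require Import exp.
From mathcomp Require Import finmap zify.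
Import Order.TTheory GRing.Theory Num.Theory.
Local Open Scope classical_set_scope.
Local Open Scope ring_scope.

(** * Ascending chains of phi-stable subgroups *)

Definition subgroup_pred {A : zmodType} (V : A -> Prop) : Prop :=
  V 0 /\ forall x y, V x -> V y -> V (x - y).

Section SubgroupPred.
Context {A : zmodType} {V : A -> Prop} (subV : subgroup_pred V).

Lemma subgroup_predN x : V x -> V (- x).
Proof. by move=> Vx; rewrite -sub0r; apply: subV.2 => //; exact: subV.1. Qed.

Lemma subgroup_predD x y : V x -> V y -> V (x + y).
Proof. by move=> Vx Vy; rewrite -[y]opprK; apply: subV.2 => //; apply: subgroup_predN. Qed.

Lemma subgroup_predMn x n : V x -> V (x *+ n).
Proof.
move=> Vx; elim: n => [|n IH]; first by rewrite mulr0n; exact: subV.1.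
by rewrite mulrS; apply: subgroup_predD.
Qed.

Lemma subgroup_predMz x (a : int) : V x -> V (x *~ a).
Proof.
case: a => n Vx; first exact: subgroup_predMn.
by rewrite NegzE mulrNz; apply: subgroup_predN; apply: subgroup_predMn.
Qed.

End SubgroupPred.

Definition ascending {A : Type} (V : nat -> A -> Prop) : Prop :=
  forall n x, V n x -> V n.+1 x.

Lemma ascending_le {A : Type} {V : nat -> A -> Prop} (ascV : ascending V)
  m n x : (m <= n)%N -> V m x -> V n x.
Proof.
move=> /subnK <-; elim: (n - m)%N => [//|k IH] Vx.
by rewrite addSn; apply: ascV; apply: IH.
Qed.

(** Euclidean division: the least positive integer met by the chain already lies in some [I N], and
    every remainder modulo it vanishes. *)
Lemma int_acc (I : nat -> int -> Prop) :
  (forall n, subgroup_pred (I n)) -> ascending I ->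
  exists N, forall n a, I n a -> I N a.
Proof.
move=> subI ascI.
pose pos_gen g := `[< (0 < g)%N /\ exists n, I n g%:Z >].
have [[g0 g0P]|noPos] := pselect (exists g, pos_gen g); last first.
  exists 0%N => n a Ina.
  have [->|a0] := eqVneq a 0; first by have [] := subI 0%N.
  case: noPos; exists `|a|%N; apply/asboolP; split; first by rewrite absz_gt0.
  exists n; have [le0a|lta0] := lerP 0 a; first by rewrite gez0_abs.
  by rewrite ltz0_abs //; apply: (subgroup_predN (subI n)).
have exg : exists g, pos_gen g by exists g0.
have [g /asboolP[g_gt0 [N Ig]] g_min] := ex_minnP exg.
exists N => n a Ina.
pose b := (a %% g%:Z)%Z.
have Ib : I (maxn n N) b.
  rewrite /b /modz; apply: (subI _).2.
    by apply: (ascending_le ascI) Ina; rewrite leq_maxl.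
  rewrite mulrC -mulrzz; apply: (subgroup_predMz (subI _)).
  by apply: (ascending_le ascI) Ig; rewrite leq_maxr.
have gZ0 : g%:Z != 0 by rewrite lt0r_neq0.
have b_ge0 : 0 <= b by rewrite modz_ge0.
have b_lt : b < g%:Z by rewrite ltz_pmod.
have b0 : b = 0.
  apply/eqP; apply: contraT => bn0.
  have /g_min : pos_gen `|b|%N.
    by apply/asboolP; split; [rewrite absz_gt0 | exists (maxn n N); rewrite gez0_abs].
  by move=> ?; exfalso; lia.
by rewrite (divz_eq a g%:Z) -/b b0 addr0 mulrC -mulrzz; apply: (subgroup_predMz (subI _)).
Qed.

Section Automorphism.
Context {K : zmodType} {phi psi : K -> K}.
Hypothesis phi_add : {morph phi : x y / x + y}.
Hypothesis phi_psi : cancel phi psi.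
Hypothesis psi_phi : cancel psi phi.

Lemma phi0 : phi 0 = 0.
Proof. by apply: (@addIr _ (phi 0)); rewrite -phi_add !add0r. Qed.

Lemma phiN : {morph phi : x / - x}.
Proof. by move=> x; apply: (@addIr _ (phi x)); rewrite -phi_add !addNr phi0. Qed.

Lemma phiB : {morph phi : x y / x - y}.
Proof. by move=> x y; rewrite phi_add phiN. Qed.

Lemma psi_add : {morph psi : x y / x + y}.
Proof. by move=> x y; rewrite -[x in LHS]psi_phi -[y in LHS]psi_phi -phi_add phi_psi. Qed.

Lemma iter_phi_add n : {morph iter n phi : x y / x + y}.
Proof. by elim: n => [//|n IH] x y; rewrite !iterS IH phi_add. Qed.

Lemma iter_phi0 n : iter n phi 0 = 0.
Proof. by elim: n => [//|n IH]; rewrite iterS IH phi0. Qed.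

Lemma iter_phiN n : {morph iter n phi : x / - x}.
Proof. by elim: n => [//|n IH] x; rewrite !iterS IH phiN. Qed.

Lemma iter_phiB n : {morph iter n phi : x y / x - y}.
Proof. by move=> x y; rewrite iter_phi_add iter_phiN. Qed.

Lemma phiMz x (a : int) : phi (x *~ a) = phi x *~ a.
Proof.
have phiMn n : phi (x *+ n) = phi x *+ n.
  by elim: n => [|n IH]; [rewrite !mulr0n phi0 | rewrite !mulrS phi_add IH].
by case: a => n; [exact: phiMn | rewrite NegzE !mulrNz phiN phiMn].
Qed.

(** * Chain condition for finitely generated modules over [Z[t, 1/t]] *)

Definition stable_subgroup (V : K -> Prop) : Prop :=
  [/\ subgroup_pred V, (forall x, V x -> V (phi x)) & (forall x, V x -> V (psi x))].

(** Only the traces of the chain on [W] must stabilize, so [W] may be a mere [Z[phi]]-submodule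
    while the [V n] are also stable under [psi]. *)
Definition noetherian_on (W : K -> Prop) : Prop :=
  forall V : nat -> K -> Prop, (forall n, stable_subgroup (V n)) -> ascending V ->
  exists N, forall n x, W x -> V n x -> V N x.

(** Elements [p(phi) r + w] with [p] an integer polynomial of degree less than [D] and [w] in
    [W]. *)
Fixpoint adjoin_upto (W : K -> Prop) (r : K) (D : nat) (x : K) : Prop :=
  if D is D'.+1 then exists a y, adjoin_upto W r D' y /\ x = iter D' phi r *~ a + y
  else W x.

Definition adjoin (W : K -> Prop) (r : K) (x : K) : Prop :=
  exists D, adjoin_upto W r D x.

Section Adjoin.
Variables (W : K -> Prop) (r : K).
Hypothesis subW : subgroup_pred W.
Hypothesis phiW : forall x, W x -> W (phi x).

Lemma adjoin_upto_subgroup D : subgroup_pred (adjoin_upto W r D).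
Proof.
elim: D => [//|D IH]; split.
  by exists 0, 0; split; [exact: IH.1 | rewrite mulr0z addr0].
move=> _ _ [a [x [Wx ->]]] [b [y [Wy ->]]].
exists (a - b), (x - y); split; first exact: IH.2.
by rewrite mulrzBr opprD addrACA.
Qed.

Lemma adjoin_upto_ascending : ascending (adjoin_upto W r).
Proof. by move=> D x Wx; exists 0, x; rewrite mulr0z add0r. Qed.

Lemma adjoin_upto_phi D x : adjoin_upto W r D x -> adjoin_upto W r D.+1 (phi x).
Proof.
elim: D x => [|D IH] x.
  by move=> Wx; apply: adjoin_upto_ascending; apply: phiW.
move=> [a [y [/IH Wy ->]]]; exists a, (phi y); split => //.
by rewrite phi_add phiMz iterS.
Qed.

Lemma adjoin_subgroup : subgroup_pred (adjoin W r).
Proof.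
split; first by exists 0%N; exact: subW.1.
move=> x y [D Wx] [E Wy]; exists (maxn D E).
apply: (adjoin_upto_subgroup _).2.
  by apply: (ascending_le adjoin_upto_ascending) Wx; rewrite leq_maxl.
by apply: (ascending_le adjoin_upto_ascending) Wy; rewrite leq_maxr.
Qed.

Lemma adjoin_phi x : adjoin W r x -> adjoin W r (phi x).
Proof. by move=> [D Wx]; exists D.+1; apply: adjoin_upto_phi. Qed.

(* As in Hilbert's basis theorem, the ideals [lead n D] of leading
   coefficients in degree [D] increase with both [n] and [D]. *)
Lemma noetherian_adjoin : noetherian_on W -> noetherian_on (adjoin W r).
Proof.
move=> noethW V stV ascV.
pose lead n D a := exists y, adjoin_upto W r D y /\ V n (iter D phi r *~ a + y).
have subV n : subgroup_pred (V n) by have [] := stV n.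
have lead_sub n D : subgroup_pred (lead n D).
  split; first by exists 0; rewrite mulr0z addr0; split;
    [exact: (adjoin_upto_subgroup D).1 | exact: (subV n).1].
  move=> a b [x [Wx Vx]] [y [Wy Vy]]; exists (x - y).
  split; first exact: (adjoin_upto_subgroup D).2.
  by rewrite mulrzBr addrACA -opprD; apply: (subV n).2.
have lead_ascl D : ascending (lead ^~ D).
  by move=> n a [y [Wy Vy]]; exists y; split => //; apply: ascV.
have lead_ascr n : ascending (lead n).
  move=> D a [y [Wy Vy]]; exists (phi y); split; first exact: adjoin_upto_phi.
  by rewrite iterS -phiMz -phi_add; have [_ + _] := stV n; apply.
(* The diagonal chain settles every degree at least [N0] at once; the finitely many lower degrees
   are treated one by one in [N1P]. *)
have [N0 N0P] : exists N0, forall n a, lead n n a -> lead N0 N0 a.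
  apply: int_acc => [n|n a]; first exact: lead_sub.
  by move=> /lead_ascr; apply: lead_ascl.
have [N1 N1P] : exists N1, forall D n a, (D < N0)%N -> lead n D a -> lead N1 D a.
  elim: (N0) => [|k [N IH]]; first by exists 0%N.
  have [M MP] := int_acc (lead ^~ k) (lead_sub ^~ k) (lead_ascl k).
  exists (maxn N M) => D n a; rewrite ltnS leq_eqVlt => /predU1P[->|ltDk] la.
    by apply: (ascending_le (lead_ascl k)) (MP _ _ la); rewrite leq_maxr.
  by apply: (ascending_le (lead_ascl D)) (IH _ _ _ ltDk la); rewrite leq_maxl.
have [N2 N2P] := noethW V stV ascV.
pose N := maxn (maxn N0 N1) N2.
have leadN n D a : lead n D a -> lead N D a.
  move=> la; have [ltD|leD] := ltnP D N0.
    by apply: (ascending_le (lead_ascl D)) (N1P _ _ _ ltD la); rewrite /N; lia.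
  apply: (ascending_le (lead_ascl D) N0); first by rewrite /N; lia.
  apply: (ascending_le (lead_ascr N0) N0) => //; apply: (N0P (maxn n D)).
  apply: (ascending_le (lead_ascr _) D); first by rewrite leq_maxr.
  by apply: (ascending_le (lead_ascl D)) la; rewrite leq_maxl.
exists N => n x [D]; elim: D n x => [|D IH] n x.
  by move=> Wx /(N2P _ _ Wx); apply: (ascending_le ascV); rewrite leq_maxr.
move=> [a [y [Wy ->]]] Vx.
have [z [Wz Vz]] : lead N D a by apply: (leadN n); exists y.
(* The element with tail [z] has the same leading coefficient and lies in [V N]; subtracting it
   leaves [y - z], of lower degree. *)
have -> : iter D phi r *~ a + y = (iter D phi r *~ a + z) + (y - z).
  by rewrite -addrA subrKC.
apply: (subgroup_predD (subV N)) => //.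
apply: (IH (maxn n N)); first exact: (adjoin_upto_subgroup D).2.
have -> : y - z = (iter D phi r *~ a + y) - (iter D phi r *~ a + z).
  by rewrite opprD addrACA subrr add0r.
apply: (subV _).2; first by apply: (ascending_le ascV) Vx; rewrite leq_maxl.
by apply: (ascending_le ascV) Vz; rewrite leq_maxr.
Qed.

End Adjoin.

Fixpoint span_forward (R : seq K) : K -> Prop :=
  if R is r :: R' then adjoin (span_forward R') r else fun x => x = 0.

Lemma span_forward_noetherian R :
  [/\ subgroup_pred (span_forward R), (forall x, span_forward R x -> span_forward R (phi x))
    & noetherian_on (span_forward R)].
Proof.
elim: R => [|r R [subR phiR noethR]] /=; first split.
- by split=> // x y -> ->; rewrite subr0.
- by move=> x ->; rewrite phi0.
- by move=> V stV _; exists 0%N => n x -> _; have [[]] := stV 0%N.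
- by split; [exact: adjoin_subgroup | exact: adjoin_phi | exact: noetherian_adjoin].
Qed.

Lemma span_forward_mem (R : seq K) r : r \in R -> span_forward R r.
Proof.
elim: R => [//|r' R IH]; rewrite inE => /predU1P[->|/IH Rr] /=; last by exists 0%N.
exists 1%N, 1, 0; split; last by rewrite mulr1z addr0.
by have [[]] := span_forward_noetherian R.
Qed.

Lemma span_forward_iter (R : seq K) r n : r \in R -> span_forward R (iter n phi r).
Proof.
move=> Rr; elim: n => [|n IH]; first exact: span_forward_mem.
by rewrite iterS; have [_ + _] := span_forward_noetherian R; apply.
Qed.

(** A forward iterate of [x] lies in [span_forward R], where the chain stabilizes; stability of
    [V N] under [psi] brings the conclusion back to [x]. *)
Lemma noetherian_generated (R : seq K) :
  (forall x, exists n, span_forward R (iter n phi x)) -> noetherian_on (fun=> True).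
Proof.
move=> genR V stV ascV.
have [_ _ /(_ V stV ascV)[N NP]] := span_forward_noetherian R.
exists N => n x _ Vx; have [a Rx] := genR x.
have : V N (iter a phi x).
  apply: (NP n) => //; elim: (a) => [//|b IH].
  by rewrite iterS; have [_ + _] := stV n; apply.
elim: (a) => [//|b IH]; rewrite iterS => VN; apply: IH.
by rewrite -[iter b phi x]phi_psi; have [_ _] := stV N; apply.
Qed.

(** * Periodic elements and kernels of powers of [phi^q - 1] *)

Definition iter_sub (q : nat) (x : K) : K := iter q phi x - x.

Lemma iter_sub_add q : {morph iter_sub q : x y / x + y}.
Proof. by move=> x y; rewrite /iter_sub iter_phi_add opprD addrACA. Qed.

Lemma iter_iter_subB q n : {morph iter n (iter_sub q) : x y / x - y}.
Proof.
elim: n => [//|n IH] x y; rewrite !iterS IH /iter_sub iter_phiB.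
by rewrite !opprD !opprK addrACA.
Qed.

Lemma iter_sub_phi q x : iter_sub q (phi x) = phi (iter_sub q x).
Proof. by rewrite /iter_sub phiB -iterSr iterS. Qed.

(** [phi^q - 1] commutes with [phi]; stability under [psi] then follows from the injectivity of
    [phi]. *)
Lemma ker_iter_sub_stable q n : stable_subgroup (fun x => iter n (iter_sub q) x = 0).
Proof.
have comm x : iter n (iter_sub q) (phi x) = phi (iter n (iter_sub q) x).
  by elim: n => [//|n IH]; rewrite !iterS IH iter_sub_phi.
split; first split.
- have : iter n (iter_sub q) (0 - 0) = 0 by rewrite iter_iter_subB subrr.
  by rewrite subr0.
- by move=> x y x0 y0; rewrite iter_iter_subB x0 y0 subr0.
- by move=> x x0; rewrite comm x0 phi0.
- move=> x x0; apply: (can_inj phi_psi).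
  by rewrite -comm psi_phi x0 phi0.
Qed.

Lemma iter_phi_fix q n x : iter q phi x = x -> iter (n * q) phi x = x.
Proof. by move=> fx; elim: n => [//|n IH]; rewrite mulSn iterD IH. Qed.

(* The two chains [Fix (phi ^ n`!)] and [ker (phi ^ P - 1) ^ n] stabilize. *)
Lemma periodic_separation : noetherian_on (fun=> True) ->
  exists P N, (0 < P)%N /\ forall q x c, (0 < q)%N -> iter q phi x = x ->
    x = iter N (iter_sub P) c -> x = 0.
Proof.
move=> noeth.
(* Factorials order the fixed subgroups by divisibility, and [q] divides [q!], so [N1!] becomes a
   common period of all periodic elements. *)
have [N1 N1P] : exists N1, forall n x, True ->
    iter 1 (iter_sub n`!) x = 0 -> iter 1 (iter_sub N1`!) x = 0.
  apply: (noeth (fun n x => iter 1 (iter_sub n`!) x = 0)) => [n|n x].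
    exact: ker_iter_sub_stable.
  by move=> /= /eqP; rewrite /iter_sub subr_eq0 factS => /eqP fx; rewrite iter_phi_fix // subrr.
have [N NP] : exists N, forall n x, True ->
    iter n (iter_sub N1`!) x = 0 -> iter N (iter_sub N1`!) x = 0.
  apply: (noeth (fun n x => iter n (iter_sub N1`!) x = 0)) => [n|n x].
    exact: ker_iter_sub_stable.
  by move=> /= ->; rewrite /iter_sub iter_phi0 subr0.
exists N1`!, N; split; first exact: fact_gt0.
(* As [phi^P] fixes [x], the power [N + 1] of [phi^P - 1] kills [c]; by stabilization the power [N]
   does too. *)
move=> q x c q0 fx xE; rewrite xE; apply: (NP N.+1) => //.
rewrite iterS -xE; apply: (N1P q) => //=.
by rewrite /iter_sub -[q]prednK // factS mulnC prednK // iter_phi_fix // subrr.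
Qed.

End Automorphism.

(** * Sums of monomials modulo powers of [phi^P - 1] *)

Lemma leq_expW2r e m n : (m <= n)%N -> (m ^ e <= n ^ e)%N.
Proof. by case: e => [//|e]; rewrite leq_exp2r. Qed.

(** Bounding each coefficient by [n] separately, rather than their sum, keeps the count a plain
    power while covering all sums of at most [n] terms. *)
Fixpoint combos {K : zmodType} (L : seq K) (n : nat) : seq K :=
  if L is y :: L' then [seq y *+ c + z | c <- iota 0 n.+1, z <- combos L' n]
  else [:: 0].

Lemma size_combos {K : zmodType} (L : seq K) n : size (combos L n) = (n.+1 ^ size L)%N.
Proof. elim: L => [//|y L IH].
by rewrite -[combos _ _]/[seq _ | c <- _, z <- _] size_allpairs size_iota IH expnS. Qed.

Lemma combos0 {K : zmodType} (L : seq K) n : 0 \in combos L n.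
Proof.
elim: L => [|y L IH]; first by rewrite inE.
by apply/allpairsP; exists (0%N, 0); rewrite mem_iota mulr0n addr0.
Qed.

Lemma combos_le {K : zmodType} (L : seq K) m n x :
  (m <= n)%N -> x \in combos L m -> x \in combos L n.
Proof.
move=> lemn; elim: L x => [//|y L IH] x /allpairsP[[c z] [cm zL ->]].
apply/allpairsP; exists (c, z); split => //; last exact: IH.
by move: cm; rewrite !mem_iota /=; lia.
Qed.

Lemma combos_add {K : zmodType} (L : seq K) n x y :
  y \in L -> x \in combos L n -> y + x \in combos L n.+1.
Proof.
elim: L x => [//|y' L IH] x; rewrite inE => /orP[/eqP->|yL] /allpairsP[[c z] [cm zL ->]].
  apply/allpairsP; exists (c.+1, z); split.
  - by move: cm; rewrite !mem_iota /=; lia.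
  - exact: combos_le zL.
  - by rewrite /= mulrS addrA.
apply/allpairsP; exists (c, y + z); split; last by rewrite /= addrCA.
- by move: cm; rewrite !mem_iota /=; lia.
- exact: IH.
Qed.

Section LaurentSums.
Context {K : zmodType} {phi : K -> K}.
Hypothesis phi_add : {morph phi : x y / x + y}.
Context {R : seq K}.
Hypothesis R_sym : forall r, r \in R -> - r \in R.

(** No signs are attached to the monomials: the symmetry of [R] absorbs them. *)
Definition monomial_sum (n H : nat) (x : K) : Prop :=
  exists l : seq (nat * K),
    [/\ (size l <= n)%N, all (fun p => (p.1 < H)%N && (p.2 \in R)) l
      & x = \sum_(p <- l) iter p.1 phi p.2].

Lemma monomial_sum0 n H : monomial_sum n H 0.
Proof. by exists [::]; rewrite big_nil. Qed.

Lemma monomial_sum_le m n H H' x : (m <= n)%N -> (H <= H')%N ->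
  monomial_sum m H x -> monomial_sum n H' x.
Proof.
move=> lemn leH [l [sl al ->]]; exists l; split=> //; first exact: leq_trans lemn.
by apply: sub_all al => p /andP[? ->]; rewrite andbT; apply: leq_trans leH.
Qed.

Lemma monomial_sum1 n H h r : (0 < n)%N -> (h < H)%N -> r \in R ->
  monomial_sum n H (iter h phi r).
Proof.
by move=> n0 hH rR; exists [:: (h, r)]; rewrite big_seq1 /= hH rR.
Qed.

Lemma monomial_sumD m n H x y : monomial_sum m H x -> monomial_sum n H y ->
  monomial_sum (m + n) H (x + y).
Proof.
move=> [l [sl al ->]] [l' [sl' al' ->]]; exists (l ++ l'); split.
- by rewrite size_cat leq_add.
- by rewrite all_cat al.
- by rewrite big_cat.
Qed.

Lemma monomial_sumN n H x : monomial_sum n H x -> monomial_sum n H (- x).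
Proof.
move=> [l [sl al ->]]; exists [seq (p.1, - p.2) | p <- l]; split.
- by rewrite size_map.
- by rewrite all_map; apply: sub_all al => p /= /andP[-> /R_sym->].
- rewrite big_map -sumrN; apply: eq_bigr => p _ /=.
  by rewrite (iter_phiN phi_add).
Qed.

Lemma monomial_sum_iter a n H x :
  monomial_sum n H x -> monomial_sum n (H + a) (iter a phi x).
Proof.
move=> [l [sl al ->]]; exists [seq ((a + p.1)%N, p.2) | p <- l]; split.
- by rewrite size_map.
- rewrite all_map; apply: sub_all al => p /= /andP[? ->].
  by rewrite andbT addnC ltn_add2r.
- rewrite big_map (big_morph _ (iter_phi_add phi_add a) (iter_phi0 phi_add a)).
  by apply: eq_bigr => p _ /=; rewrite iterD.
Qed.

Lemma monomial_sum_ind (n H : nat) (Q : nat -> K -> Prop) :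
  Q 0%N 0 ->
  (forall m h r x, (h < H)%N -> r \in R -> Q m x -> Q m.+1 (iter h phi r + x)) ->
  forall x, monomial_sum n H x -> exists2 m, (m <= n)%N & Q m x.
Proof.
move=> Q0 QS x [l [sl al ->]]; exists (size l) => //.
elim: l {sl} al => [|[h r] l IH] /=; first by rewrite big_nil.
by move=> /andP[/andP[hH rR] /IH Ql]; rewrite big_cons; apply: QS.
Qed.

(** * Division with remainder by [phi^q - 1] *)

Definition window (q : nat) : seq K := [seq iter h phi r | h <- iota 0 q, r <- R].

Lemma size_window q : size (window q) = (q * size R)%N.
Proof. by rewrite size_allpairs size_iota. Qed.

Lemma window_mem q h r : (h < q)%N -> r \in R -> iter h phi r \in window q.
Proof. by move=> hq rR; apply/allpairsP; exists (h, r); rewrite mem_iota. Qed.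

Lemma monomial_sum_combos n q x : monomial_sum n q x -> x \in combos (window q) n.
Proof.
move=> /(@monomial_sum_ind _ _ (fun m x => x \in combos (window q) m)) [||m lemn].
- exact: combos0.
- by move=> m h r y hq rR; apply: combos_add; apply: window_mem.
- exact: combos_le.
Qed.

(** Telescoping: [phi^h r] is [phi^(h-q) r] plus the image of [phi^(h-q) r] under [phi^q - 1]. Each
    descent by [q] adds one monomial to [b]. *)
Lemma monomial_reduce q h r : (0 < q)%N -> r \in R ->
  exists h' b, [/\ (h' < q)%N, monomial_sum h h b
    & iter h phi r = iter h' phi r + iter_sub (phi := phi) q b].
Proof.
move=> q0 rR; elim/ltn_ind: h => h IH; have [hq|qh] := ltnP h q.
  exists h, 0; split=> //; first exact: monomial_sum0.
  by rewrite /iter_sub (iter_phi0 phi_add) subr0 addr0.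
have lth : (h - q < h)%N by lia.
have [h' [b [h'q bh E]]] := IH _ lth.
exists h', (b + iter (h - q) phi r); split=> //.
  have : monomial_sum (h - q + 1) h (b + iter (h - q) phi r).
    apply: monomial_sumD; last exact: monomial_sum1.
    by apply: monomial_sum_le bh; lia.
  by apply: monomial_sum_le; lia.
rewrite (iter_sub_add phi_add) addrA -E /iter_sub -iterD subnKC // addrC.
by rewrite subrK.
Qed.

Lemma monomial_sum_reduce n H q x : (0 < q)%N -> monomial_sum n H x ->
  exists x0 b, [/\ monomial_sum n q x0, monomial_sum (n * H) H b
    & x = x0 + iter_sub (phi := phi) q b].
Proof.
move=> q0 /(@monomial_sum_ind _ _ (fun m x => exists x0 b,
  [/\ monomial_sum m q x0, monomial_sum (m * H) H b
    & x = x0 + iter_sub (phi := phi) q b])) [||m lemn].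
- exists 0, 0; split; [exact: monomial_sum0 | exact: monomial_sum0 |].
  by rewrite /iter_sub (iter_phi0 phi_add) subr0 addr0.
- move=> m h r y hH rR [x0 [b [x0P bP ->]]].
  have [h' [b' [h'q b'P ->]]] := monomial_reduce q h r q0 rR.
  exists (iter h' phi r + x0), (b' + b); split.
  + by rewrite -add1n; apply: monomial_sumD => //; apply: monomial_sum1.
  + rewrite mulSn; apply: monomial_sumD => //.
    by apply: monomial_sum_le b'P; apply: ltnW.
  + by rewrite (iter_sub_add phi_add) addrACA.
- move=> [x0 [b [x0P bP ->]]]; exists x0, b; split=> //.
    exact: monomial_sum_le x0P.
  by apply: monomial_sum_le bP; rewrite ?leq_mul2r ?lemn ?orbT.
Qed.

Lemma monomial_sum_span n H x : monomial_sum n H x -> span_forward (phi := phi) R x.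
Proof.
have [subR _ _] := span_forward_noetherian (psi := id) phi_add R.
move=> [l [_ + ->]]; elim: l => [|p l IH] /=; first by rewrite big_nil => _; exact: subR.1.
move=> /andP[/andP[_ pR] /IH Rl]; rewrite big_cons.
by apply: (subgroup_predD subR) => //; apply: (span_forward_iter (psi := id)).
Qed.

(* Base-[phi^P - 1] expansion with [N] digits, each in [combos (window P)]. *)
Lemma monomial_sum_cover P N n H : (0 < P)%N -> (0 < H)%N ->
  exists l : seq K, (size l <= (n * H ^ N).+1 ^ (P * size R * N))%N /\
    forall x, monomial_sum n H x ->
      exists2 y, y \in l & exists c, x - y = iter N (iter_sub (phi := phi) P) c.
Proof.
move=> P0 H0; elim: N n => [|N IH] n.
  exists [:: 0]; split; first by rewrite muln0 expn0.
  by move=> x _; exists 0; [rewrite inE | exists x; rewrite subr0].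
(* The quotient [b] left after the lowest digit has up to [n * H] monomials, so the remaining digits
   are expanded with that bound. *)
have [l [sl lP]] := IH (n * H)%N.
exists [seq x0 + iter_sub (phi := phi) P y | x0 <- combos (window P) n, y <- l]; split.
  rewrite size_allpairs size_combos size_window.
  rewrite [X in (_ <= _ ^ X)%N]mulnS expnD leq_mul //.
    by apply: leq_expW2r; rewrite ltnS leq_pmulr ?expn_gt0 ?H0.
  by rewrite expnS mulnA.
move=> x /(monomial_sum_reduce _ _ _ _ P0)[x0 [b [x0P bP ->]]].
have [y yl [c E]] := lP _ bP.
exists (x0 + iter_sub (phi := phi) P y).
  by apply/allpairsP; exists (x0, y); split=> //; apply: monomial_sum_combos.
exists c; rewrite iterS -E opprD addrACA subrr add0r.
exact/esym/(iter_iter_subB phi_add P 1).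
Qed.

End LaurentSums.

(** * Conjugation in the semidirect product *)

Section SemidirectProduct.
Context {K : zmodType} {phi psi : K -> K}.
Hypothesis phi_add : {morph phi : x y / x + y}.
Hypothesis phi_psi : cancel phi psi.
Hypothesis psi_phi : cancel psi phi.
Local Notation phiz := (phiz phi psi).
Local Notation gmul := (gmul phi psi).
Local Notation ginv := (ginv phi psi).
Local Notation eval := (eval_word phi psi).
Local Notation conj_class := (conj_class phi psi).

Lemma phizS m x : phiz (m + 1) x = phi (phiz m x).
Proof.
case: m => [n|[|n]]; first by rewrite -PoszD addn1.
  by rewrite /= psi_phi.
by rewrite (_ : Negz n.+1 + 1 = Negz n) /= ?psi_phi //; lia.
Qed.

Lemma phizP m x : phiz (m - 1) x = psi (phiz m x).
Proof. by rewrite -{2}[m](subrK 1) phizS phi_psi. Qed.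

Lemma phizD m n x : phiz (m + n) x = phiz m (phiz n x).
Proof.
case: m => m; first by elim: m => [|m IH]; rewrite ?add0r // -addn1 PoszD addrAC !phizS IH.
rewrite NegzE; elim: m.+1 => {m} [|m IH]; first by rewrite oppr0 add0r.
by rewrite -addn1 PoszD opprD addrAC !phizP IH.
Qed.

Lemma phizK m : cancel (phiz m) (phiz (- m)).
Proof. by move=> x; rewrite -phizD addNr. Qed.

Lemma phiz_add m : {morph phiz m : x y / x + y}.
Proof.
case: m => n x y /=; first exact: (iter_phi_add phi_add).
elim: n => [|n /= IH]; first exact: (psi_add phi_add phi_psi psi_phi).
by rewrite IH (psi_add phi_add phi_psi psi_phi).
Qed.

Lemma phiz0 m : phiz m 0 = 0.
Proof. by apply: (@addIr _ (phiz m 0)); rewrite -phiz_add !add0r. Qed.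

Lemma phizN m : {morph phiz m : x / - x}.
Proof. by move=> x; apply: (@addIr _ (phiz m x)); rewrite -phiz_add !addNr phiz0. Qed.

Lemma phizC m n x : phiz m (phiz n x) = phiz n (phiz m x).
Proof. by rewrite -!phizD addrC. Qed.

Lemma gmulA : associative gmul.
Proof.
by move=> [a i] [b j] [c k]; rewrite /gmul /= phiz_add phizD !addrA.
Qed.

Lemma gmul1g : left_id (gone K) gmul.
Proof. by move=> [a i]; rewrite /gmul /= !add0r. Qed.

Lemma gmulg1 : right_id (gone K) gmul.
Proof. by move=> [a i]; rewrite /gmul /= phiz0 !addr0. Qed.

Lemma gmulVg x : gmul (ginv x) x = gone K.
Proof. by case: x => [a i]; rewrite /gmul /ginv /= !addNr. Qed.

Lemma gmulgV x : gmul x (ginv x) = gone K.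
Proof.
by case: x => [a i]; rewrite /gmul /ginv /= phizN -phizD !subrr.
Qed.

Definition gconj g x := gmul (ginv x) (gmul g x).

Lemma gconjM g x y : gconj (gconj g x) y = gconj g (gmul x y).
Proof.
have ginvM : ginv (gmul x y) = gmul (ginv y) (ginv x).
  have E : gmul (gmul x y) (gmul (ginv y) (ginv x)) = gone K.
    by rewrite gmulA -(gmulA x) gmulgV gmulg1 gmulgV.
  by rewrite -[LHS]gmulg1 -E gmulA gmulVg gmul1g.
by rewrite /gconj ginvM !gmulA.
Qed.

Lemma conj_class_gconj g x : conj_class (gconj g x) = conj_class g.
Proof.
apply/seteqP; split => h [y ->]; first by exists (gmul x y); rewrite -/(gconj _ _) gconjM.
exists (gmul (ginv x) y); rewrite -!/(gconj _ _) gconjM gmulA gmulgV.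
by rewrite gmul1g.
Qed.

Lemma gconjE g x :
  gconj g x = (phiz (- x.2) (g.1 - x.1 + phiz g.2 x.1), g.2).
Proof.
case: g x => [k m] [a i]; rewrite /gconj /gmul /ginv /=; congr (_, _).
  by rewrite -phizN -phiz_add addrCA addrA.
by rewrite addrC addrK.
Qed.

Lemma conj_class_phiz a k m : conj_class (phiz a k, m) = conj_class (k, m).
Proof.
by rewrite -(conj_class_gconj (k, m) (0, - a)) gconjE /= opprK phiz0 addr0 subr0.
Qed.

Lemma conj_class_translate b k m : conj_class (k - b + phiz m b, m) = conj_class (k, m).
Proof. by rewrite -(conj_class_gconj (k, m) (b, 0)) gconjE. Qed.

Lemma eval_cat u v : eval (u ++ v) = gmul (eval u) (eval v).
Proof. by elim: u => [|s u IH] /=; rewrite ?gmul1g // IH gmulA. Qed.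

(** [v u] is the conjugate of [u v] by [u]. *)
Lemma eval_rot i w : eval (rot i w) = gconj (eval w) (eval (take i w)).
Proof.
have -> : eval w = gmul (eval (take i w)) (eval (drop i w)).
  by rewrite -eval_cat cat_take_drop.
by rewrite /rot eval_cat /gconj !gmulA gmulVg gmul1g.
Qed.

(** Equal conjugates by [x] and [y] make [g] commute with [y x^-1], which is [(z, t^q)]; the
    equation is the first coordinate of this commutation. *)
Lemma gconj_eq_commute g x y : gconj g x = gconj g y ->
  let q := y.2 - x.2 in let z := y.1 - phiz q x.1 in
  g.1 + phiz g.2 z = z + phiz q g.1.
Proof.
rewrite !gconjE => -[/(congr1 (phiz y.2))]; rewrite -!phizD subrr /= => E.
rewrite !phiz_add !phizN in E *; rewrite (phizC g.2).
move: E; set C := phiz _ (phiz _ x.1); set A := phiz _ g.1; set B := phiz _ x.1.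
set D := phiz g.2 y.1 => E.
have -> : D = A - B + C - g.1 + y.1.
  by rewrite E [RHS](AC 5 (3*((1*4)*(2*5))))%AC /= subrr addNr !addr0.
rewrite [LHS](AC (1*(5*1)) ((1*5)*((4*7)*(6*3*2))))%AC /=.
by rewrite !subrr !add0r.
Qed.

(** Both equations express commutation; the second results from conjugating [(x, t^m)] and
    [(w, t^q)] simultaneously by [(-b, 1)]. *)
Lemma commute_translate q m x w0 b :
  let w := w0 + iter_sub (phi := phi) q b in let x' := x + b - phiz m b in
  x + phiz m w = w + iter q phi x -> x' + phiz m w0 = w0 + iter q phi x'.
Proof.
rewrite /= /iter_sub -![iter q phi _]/(phiz q%:Z _) => E.
rewrite !phiz_add !phizN in E *; rewrite (phizC q%:Z m).
move: E; set A := phiz _ x; set B := phiz q b; set C := phiz m b.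
set D := phiz m w0; set F := phiz m B => /(congr1 (fun t => t + (b - F))) E.
transitivity (x + (D + (F - C)) + (b - F)).
  by rewrite [RHS](AC ((1*(1*2))*2) ((3*6)*(1*5*4*2)))%AC /= subrr add0r.
by rewrite E [LHS](AC ((1*2)*1*2) ((3*5)*(1*(4*2*6))))%AC /= addNr add0r.
Qed.

End SemidirectProduct.

(** * Words and cyclic shifts *)

(** Discrete intermediate value theorem. When [n.+1] is one of the two bounds and misses [c], the
    index [n] bounds [c] on the same side, since a step is at most 1. *)
Lemma int_path_interval (a : nat -> int) (n : nat) :
  (forall i, (i < n)%N -> `|a i.+1 - a i| <= 1) ->
  forall i j c, (i <= n)%N -> (j <= n)%N -> a i <= c <= a j ->
  exists2 k, (k <= n)%N & a k = c.
Proof.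
elim: n => [|n IH] step i j c.
  by rewrite !leqn0 => /eqP-> /eqP-> ?; exists 0%N => //; lia.
have {}IH := IH (fun i lti => step i (ltnW lti)).
have stepn := step n (ltnSn n).
have [<-|ne] := eqVneq (a n.+1) c; first by exists n.+1.
have IH' i' j' : (i' <= n)%N -> (j' <= n)%N -> a i' <= c <= a j' ->
    exists2 k, (k <= n.+1)%N & a k = c.
  by move=> i'n j'n /(IH _ _ _ i'n j'n)[k kn <-]; exists k => //; apply: leqW.
rewrite [(i <= _)%N]leq_eqVlt [(j <= _)%N]leq_eqVlt.
move=> /predU1P[->|ltin] /predU1P[->|ltjn] c_btw.
- by exists n.+1 => //; lia.
- by apply: (IH' n j) => //; lia.
- by apply: (IH' i n) => //; lia.
- exact: (IH' i j).
Qed.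

(** The covering list also proves finiteness, so [fset_set] does not fall to its default value. *)
Lemma nclasses_le {K : zmodType} {phi psi : K -> K} (A : set (K * int))
    (l : seq (set (K * int))) :
  (forall g, A g -> conj_class phi psi g \in l) -> (nclasses phi psi A <= size l)%N.
Proof.
move=> Al; rewrite /nclasses.
set C := [set conj_class phi psi g | g in A].
have subC : C `<=` [set` l] by move=> _ [g Ag <-]; exact: Al.
have finC : finite_set C by apply: sub_finite_set subC _.
apply: uniq_leq_size; first exact: fset_uniq.
by move=> c; rewrite in_fset_set // => /set_mem /subC.
Qed.

(** [cl t] is the union of all classes with code [t], which reduces to one class because a code
    determines its class. *)
Lemma classes_code {K : zmodType} {phi psi : K -> K} {T : eqType}
    (A : set (K * int)) (l : seq T) (code : K * int -> T -> Prop) :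
  (forall g, A g -> exists2 t, t \in l & code g t) ->
  (forall g g' t, code g t -> code g' t -> conj_class phi psi g = conj_class phi psi g') ->
  exists l' : seq (set (K * int)), size l' = size l /\
    forall g, A g -> conj_class phi psi g \in l'.
Proof.
move=> codeA code_inj.
pose cl t := [set h | exists2 g, code g t & conj_class phi psi g h].
exists [seq cl t | t <- l]; split; first by rewrite size_map.
move=> g /codeA[t tl gt]; apply/mapP; exists t => //.
apply/seteqP; split => h; first by exists g.
by move=> [g' g't]; rewrite (code_inj _ _ _ gt g't).
Qed.

Lemma uniq_size_fset_set {T : choiceType} (A : set T) (s : seq T) : finite_set A ->
  uniq s -> (forall x, x \in s -> A x) -> (size s <= #|` fset_set A|)%N.
Proof.
move=> finA us sA.
by apply: uniq_leq_size => // x /sA Ax; rewrite in_fset_set // mem_set.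
Qed.

Section Words.
Context {K : zmodType} {phi psi : K -> K}.
Hypothesis phi_add : {morph phi : x y / x + y}.
Hypothesis phi_psi : cancel phi psi.
Hypothesis psi_phi : cancel psi phi.
Context {R : seq K}.
Local Notation phiz := (phiz phi psi).
Local Notation eval := (eval_word phi psi).
Local Notation gens_word w := (forall s, s \in w -> gens R s).

Lemma gens_step s : gens R s -> `|s.2| <= 1.
Proof. by move=> [[_ ->]|[->|->]]. Qed.

Lemma height_step w i : gens_word w -> (i < size w)%N ->
  `|(eval (take i.+1 w)).2 - (eval (take i w)).2| <= 1.
Proof.
move=> gw iw; rewrite (take_nth (gone K)) // -cats1 (eval_cat phi_add phi_psi psi_phi) /=.
rewrite addr0 addrC addKr; apply: gens_step; apply: gw; exact: mem_nth.
Qed.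

Lemma height_bound w i : gens_word w -> (i <= size w)%N -> `|(eval (take i w)).2| <= i%:Z.
Proof.
move=> gw; elim: i => [|i IH] iw; first by rewrite take0.
by have := height_step w i gw iw; have := IH (ltnW iw); lia.
Qed.

Lemma gens_take w i : gens_word w -> gens_word (take i w).
Proof. by move=> gw s /mem_take /gw. Qed.

(** A letter from [R] read at height [h] contributes [phi^h] of itself, and [t] only moves the
    height. The shift [a] makes all exponents nonnegative. *)
Lemma word_monomial_sum w H (a : int) : gens_word w ->
  (forall i, (i <= size w)%N -> 0 <= a + (eval (take i w)).2 < H%:Z) ->
  monomial_sum (phi := phi) (R := R) (size w) H (phiz a (eval w).1).
Proof.
elim: w a => [|s w IH] a gw bnd.
  by rewrite /= (phiz0 phi_add phi_psi psi_phi); exact: monomial_sum0.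
have gw' : gens_word w by move=> t tw; apply: gw; rewrite inE tw orbT.
have {IH} : monomial_sum (phi := phi) (R := R) (size w) H (phiz (a + s.2) (eval w).1).
  by apply: IH => // i iw; have := bnd i.+1 iw; rewrite /= addrA.
have := bnd 0%N isT; rewrite /= addr0 (phizD phi_psi psi_phi).
have /gw[[sR s0]|s0] : s \in s :: w by rewrite inE eqxx.
  rewrite s0 (phiz_add phi_add phi_psi psi_phi) addrC -addn1.
  case: a {bnd} => // a aH wP; apply: monomial_sumD => //.
  exact: monomial_sum1.
have -> : s.1 = 0 by case: s0 => ->.
by move=> _; rewrite add0r; apply: monomial_sum_le.
Qed.

(** * Word length, spheres and cyclic shifts of geodesic words *)

Lemma wlen_le g n : has_word_len phi psi R g n -> (wlen phi psi R g <= n)%N.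
Proof.
move=> gn; rewrite /wlen; case: pselect => [h|//].
by case: ex_minnP => m _; apply; apply/asboolP.
Qed.

Hypothesis S_gen : forall g : K * int, exists w : seq (K * int), gens_word w /\ eval w = g.

(** Generation excludes the default value 0 in [wlen]. *)
Lemma wlen_word g : has_word_len phi psi R g (wlen phi psi R g).
Proof.
have [w [gw wg]] := S_gen g; rewrite /wlen; case: pselect => [h|[]].
  by case: ex_minnP => m /asboolP.
by exists (size w); apply/asboolP; exists w.
Qed.

(** There are finitely many words of length [r]. Finiteness ensures that the cardinal of [fset_set]
    on a class within the sphere is the true one. *)
Lemma finite_sphere r : finite_set (sphere phi psi R r).
Proof.
pose letters := [seq (x, 0) | x <- R] ++ [:: (0, 1); (0, -1)] : seq (K * int).
pose fix words n : seq (K * int) :=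
  if n is n'.+1 then [seq gmul phi psi s g | s <- letters, g <- words n'] else [:: gone K].
apply: (@sub_finite_set _ _ [set` words r]); last by [].
move=> g <-; have [w [<- [gw <-]]] := wlen_word g.
elim: w gw => [|s w IH] gw; first by rewrite /= inE.
apply/allpairsP; exists (s, eval w); split => //=; last first.
  by apply: IH => t tw; apply: gw; rewrite inE tw orbT.
rewrite mem_cat !inE; have /gw[[sR s0]|[->|->]] : s \in s :: w by rewrite inE eqxx.
- apply/orP; left; apply/mapP; exists s.1 => //; rewrite -s0.
  by case: (s).
- by rewrite eqxx orbT.
- by rewrite eqxx !orbT.
Qed.

(** The rotated word bounds the length by [r] from above; minimality of [eval w] in its class bounds
    it from below. *)
Lemma rot_sphere' r w i : gens_word w -> size w = r ->
  sphere' phi psi R r (eval w) ->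
  (conj_class phi psi (eval w) `&` sphere phi psi R r)
    (gconj (phi := phi) (psi := psi) (eval w) (eval (take i w))).
Proof.
move=> gw sw [lw minw]; set h := gconj _ _.
have wh : conj_class phi psi (eval w) h by exists (eval (take i w)).
split => //; apply/eqP; rewrite eqn_leq -{2}lw minw // andbT.
apply: wlen_le; exists (rot i w); split; first by rewrite size_rot.
split; last exact: (eval_rot phi_add phi_psi psi_phi).
by move=> s; rewrite mem_rot; apply: gw.
Qed.

(* Pigeonhole among the cyclic shifts of a geodesic word of [g] cut at the
   [q0 + 1] lowest heights. *)
Lemma sphere'_dichotomy r q0 g : sphere' phi psi R r g ->
  (#|` fset_set (conj_class phi psi g `&` sphere phi psi R r)| <= q0)%N ->
  (exists2 x, conj_class phi psi g = conj_class phi psi (x, 0)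
     & monomial_sum (phi := phi) (R := R) r q0 x)
  \/ exists q k k', [/\ (0 < q)%N, (q <= q0)%N & (q <= r.*2)%N] /\
     [/\ g.1 + phiz g.2 (k' - phiz q%:Z k) = k' - phiz q%:Z k + phiz q%:Z g.1,
         monomial_sum (phi := phi) (R := R) r r.*2.+1 (phiz r%:Z g.1),
         monomial_sum (phi := phi) (R := R) r r.*2.+1 (phiz r%:Z k),
         monomial_sum (phi := phi) (R := R) r r.*2.+1 (phiz r%:Z k')
       & `|g.2| <= r%:Z].
Proof.
move=> gS card_q0; have [w [sw [gw wg]]] := wlen_word g.
have {}sw : size w = r by rewrite sw; case: gS.
pose p i := eval (take i w); pose h i := (p i).2.
pose cj i := gconj (phi := phi) (psi := psi) g (p i).
have cjP i : (conj_class phi psi g `&` sphere phi psi R r) (cj i).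
  by rewrite /cj -wg; apply: rot_sphere' => //; rewrite wg.
have pr : p r = g by rewrite /p -sw take_size.
have h_bnd i : (i <= r)%N -> `|h i| <= r%:Z.
  by move=> ir; have := height_bound w i gw; rewrite -/(p i) -/(h i) sw => /(_ ir); lia.
(* Prefix heights lie between [-r] and [r]; the shift by [r] leaves [r.*2.+1] possible exponents. *)
have p_sum i : (i <= r)%N -> monomial_sum (phi := phi) (R := R) r r.*2.+1 (phiz r%:Z (p i).1).
  move=> ir; apply: (@monomial_sum_le _ _ _ (size (take i w)) _ r.*2.+1) => //.
    by rewrite size_take_min sw geq_minr.
  apply: word_monomial_sum; first exact: gens_take.
  move=> j; rewrite size_take_min leq_min => /andP[ji jw].
  rewrite take_takel //; have := h_bnd j (leq_trans ji ir); rewrite /h /p.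
  by move: (eval _).2 => t; lia.
have [[i [j [ir jr hij hji cij]]]|noPair] := pselect (exists i j,
    [/\ (i <= r)%N, (j <= r)%N, h i < h j, h j <= h i + q0%:Z & cj i = cj j]).
  right; exists `|h j - h i|%N, (p i).1, (p j).1.
  have := h_bnd i ir; have := h_bnd j jr; move=> hj hi.
  have qE : `|h j - h i|%N%:Z = h j - h i by rewrite gez0_abs; lia.
  split; first by split; lia.
  split; try exact: p_sum; last by rewrite -pr; apply: h_bnd.
    by rewrite qE; apply: (gconj_eq_commute phi_add phi_psi psi_phi).
  by rewrite -pr; apply: p_sum.
left; have [i0 i0r i0min] : exists2 i0, (i0 <= r)%N & forall i, (i <= r)%N -> h i0 <= h i.
  have [i0 _ i0min] := Order.TotalTheory.arg_minP (fun i : 'I_r.+1 => h i) (isT : xpredT ord0).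
  exists (val i0) => [|i]; first by rewrite -ltnS ltn_ord.
  by rewrite -ltnS => ir; apply: (i0min (Ordinal ir)).
have h_lt i : (i <= r)%N -> h i < h i0 + q0%:Z.
  move=> ir; rewrite ltNge; apply/negP => le_hi.
  (* Were height [h i0 + q0] reached, the path would visit each of the [q0 + 1] lowest levels;
     [pos c] is a visit to level [c]. *)
  have /choice[pos posP] : forall c, exists k, (c <= q0)%N -> (k <= r)%N /\ h k = h i0 + c%:Z.
    move=> c; have [cq|] := leqP c q0; last by exists 0%N.
    have [||k kr kE] := @int_path_interval h r _ i0 i (h i0 + c%:Z) i0r ir.
    - by move=> k kr; apply: height_step; rewrite ?sw.
    - by lia.
    - by exists k.
  pose s := [seq cj (pos c) | c <- iota 0 q0.+1].
  have : ~~ uniq s.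
    apply/negP => us.
    have finA : finite_set (conj_class phi psi g `&` sphere phi psi R r).
      by apply: sub_finite_set (finite_sphere r) => x [].
    have sA x : x \in s -> (conj_class phi psi g `&` sphere phi psi R r) x.
      by move=> /mapP[c _ ->]; exact: cjP.
    have := leq_trans (uniq_size_fset_set _ s finA us sA) card_q0.
    by rewrite size_map size_iota ltnn.
  move=> /(uniqPn (0, 0))[c [c' [cc']]]; rewrite size_map size_iota => c'q.
  rewrite !(nth_map 0%N) ?size_iota; try lia.
  rewrite !nth_iota ?add0n; try lia.
  move=> E; apply: noPair; exists (pos c), (pos c').
  have [cr hc] := posP c ltac:(lia); have [c'r hc'] := posP c' ltac:(lia).
  by split => //; lia.
(* Cutting at [0] and at [r] both give [g] back, so a nonzero [g.2], being less than [q0] in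
   absolute value, would yield an excluded pair. *)
have g0 : g.2 = 0.
  have hr : h r = g.2 by rewrite /h pr.
  have h0 : h 0%N = 0 by rewrite /h /p take0.
  have cjr : cj r = cj 0%N.
    rewrite /cj pr /p take0 !(gconjE phi_add phi_psi psi_phi) /=.
    rewrite subrr add0r (phizK phi_psi psi_phi).
    by rewrite (phiz0 phi_add phi_psi psi_phi) subr0 addr0.
  apply/eqP; apply: contraT => gn0; exfalso; apply: noPair.
  have := i0min r (leqnn r); have := i0min 0%N isT.
  have := h_lt r (leqnn r); have := h_lt 0%N isT.
  rewrite hr h0; have [gpos|gneg] := ltrP 0 g.2.
    by exists 0%N, r; rewrite hr h0; split => //; lia.
  by exists r, 0%N; rewrite hr h0; split => //; lia.
(* Conjugation by a power of [t] brings the lowest height to 0. *)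
exists (phiz (- h i0) g.1).
  by rewrite (conj_class_phiz phi_add phi_psi psi_phi) -g0; case: (g).
rewrite -pr -{1}sw /p -sw take_size; apply: word_monomial_sum => // i.
rewrite sw => ir; have := h_lt i ir; have := i0min i ir.
by rewrite /h /p; move: (eval _).2 (eval _).2 => t u; lia.
Qed.

End Words.

(** * Counting conjugacy classes *)

Section Counting.
Context {K : zmodType} {phi psi : K -> K}.
Hypothesis phi_add : {morph phi : x y / x + y}.
Hypothesis phi_psi : cancel phi psi.
Hypothesis psi_phi : cancel psi phi.
Context {R : seq K}.
Hypothesis R_sym : forall r, r \in R -> - r \in R.
Hypothesis S_gen : forall g : K * int, exists w : seq (K * int),
  (forall s, s \in w -> gens R s) /\ eval_word phi psi w = g.
Local Notation phiz := (phiz phi psi).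
Local Notation monomial_sum := (monomial_sum (phi := phi) (R := R)).

(** A word for [(x, 0)] never goes below height [-size w], so [phi^(size w)] clears all negative
    exponents. *)
Lemma span_forward_generates x : exists n, span_forward (phi := phi) R (iter n phi x).
Proof.
have [w [gw wx]] := S_gen (x, 0); exists (size w).
have -> : x = (eval_word phi psi w).1 by rewrite wx.
apply: (monomial_sum_span phi_add (size w) (size w).*2.+1).
apply: (word_monomial_sum phi_add phi_psi psi_phi w _ (size w)%:Z) => // i iw.
have bnd (n j : nat) (t : int) : (j <= n)%N -> `|t| <= j%:Z -> 0 <= n%:Z + t < n.*2.+1%:Z.
  by lia.
exact: bnd iw (height_bound phi_add phi_psi psi_phi w i gw iw).
Qed.

(** Division of the commuting element by [phi^q - 1] gives [w0] and [b], and conjugation by [b]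
    transfers the relation to [w0]. Powers of [t] only serve to keep exponents nonnegative. *)
Lemma commuting_reduce q r (m : int) (g k k' : K) : (0 < q)%N -> (q <= r.*2)%N ->
  `|m| <= r%:Z ->
  g + phiz m (k' - phiz q%:Z k) = k' - phiz q%:Z k + phiz q%:Z g ->
  monomial_sum r r.*2.+1 (phiz r%:Z g) ->
  monomial_sum r r.*2.+1 (phiz r%:Z k) ->
  monomial_sum r r.*2.+1 (phiz r%:Z k') ->
  exists x w0, [/\ conj_class phi psi (x, m) = conj_class phi psi (g, m),
    monomial_sum r.*2 q w0,
    monomial_sum (r + r.*2 * (4 * r).+1 * 2) (6 * r).+1 x
    & x + phiz m (iter r phi w0) = iter r phi w0 + iter q phi x].
Proof.
move=> q0 qr mr comm gP kP k'P.
have [w0 [b [w0P bP wE]]] : exists w0 b, [/\ monomial_sum r.*2 q w0,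
    monomial_sum (r.*2 * (4 * r).+1) (4 * r).+1 b
    & phiz r%:Z (k' - phiz q%:Z k) = w0 + iter_sub (phi := phi) q b].
  apply: (monomial_sum_reduce phi_add) => //.
  rewrite (phiz_add phi_add phi_psi psi_phi) (phizN phi_add phi_psi psi_phi).
  rewrite (phizC phi_psi psi_phi) -addnn; apply: monomial_sumD.
    by apply: monomial_sum_le k'P => //; lia.
  apply: (monomial_sumN phi_add R_sym).
  have := monomial_sum_iter phi_add q _ _ _ kP.
  by apply: monomial_sum_le => //; lia.
pose x' := phiz r%:Z g + b - phiz m b.
have commx' : x' + phiz m w0 = w0 + iter q phi x'.
  apply: (commute_translate phi_add phi_psi psi_phi); rewrite -wE.
  rewrite (phizC phi_psi psi_phi m) -(phiz_add phi_add phi_psi psi_phi) comm.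
  by rewrite (phiz_add phi_add phi_psi psi_phi) -(phizC phi_psi psi_phi q).
(* The second shift by [r] compensates a negative [m] in [phi^m b]; as [r + m] is at most [2 r],
   exponents stay below [6 r + 1]. *)
exists (phiz r%:Z x'), w0; split => //.
- rewrite (conj_class_phiz phi_add phi_psi psi_phi).
  have -> : x' = phiz r%:Z g - (- b) + phiz m (- b).
    by rewrite (phizN phi_add phi_psi psi_phi) opprK.
  rewrite (conj_class_translate phi_add phi_psi psi_phi).
  by rewrite (conj_class_phiz phi_add phi_psi psi_phi).
- rewrite !(phiz_add phi_add phi_psi psi_phi) (phizN phi_add phi_psi psi_phi).
  rewrite -(phizD phi_psi psi_phi r%:Z m) muln2 -addnn addnA.
  have -> : r%:Z + m = (absz (r%:Z + m))%:Z by rewrite gez0_abs; lia.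
  apply: monomial_sumD; first apply: monomial_sumD.
  + have := monomial_sum_iter phi_add r _ _ _ gP.
    by apply: monomial_sum_le => //; lia.
  + have := monomial_sum_iter phi_add r _ _ _ bP.
    by apply: monomial_sum_le => //; lia.
  + apply: (monomial_sumN phi_add R_sym).
    have := monomial_sum_iter phi_add (absz (r%:Z + m)) _ _ _ bP.
    by apply: monomial_sum_le => //; lia.
- rewrite -![iter _ phi _]/(phiz _%:Z _) (phizC phi_psi psi_phi m).
  rewrite -(phiz_add phi_add phi_psi psi_phi) commx'.
  by rewrite (phiz_add phi_add phi_psi psi_phi) -(phizC phi_psi psi_phi q).
Qed.

(** Classes outside [small] are coded by [q], [w0], [m] and a residue [y] of [x]. In the exponent,
    [q] and [m] cost 2 each, [y] the middle term, [w0] the last, and adding the [small] classes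
    costs 1. *)
Lemma nclasses_bound P N : (0 < P)%N ->
  (forall q x c, (0 < q)%N -> iter q phi x = x ->
    x = iter N (iter_sub (phi := phi) P) c -> x = 0) ->
  forall r q0 (A : set (K * int)), (21 <= r)%N ->
  (forall g, A g -> sphere' phi psi R r g /\
    (#|` fset_set (conj_class phi psi g `&` sphere phi psi R r)| <= q0)%N) ->
  (nclasses phi psi A <=
    r ^ (5 + (2 * N + 4) * (P * size R * N) + 2 * (q0 * size R)))%N.
Proof.
move=> P0 sep r q0 A r21 AP.
pose small g := exists2 x, conj_class phi psi g = conj_class phi psi (x, 0)
  & monomial_sum r q0 x.
have r0 : (0 < r)%N by lia.
have combos_size n : (n <= r.*2)%N ->
    (size (combos (window (phi := phi) (R := R) q0) n) <= r ^ (2 * (q0 * size R)))%N.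
  move=> nr; rewrite size_combos size_window [(r ^ _)%N]expnM; apply: leq_expW2r.
  by rewrite -mulnn; nia.
have [l1 [sl1 l1P]] : exists l : seq (set (K * int)),
    size l = size (combos (window (phi := phi) (R := R) q0) r) /\
    forall g, (A `&` small) g -> conj_class phi psi g \in l.
  apply: (classes_code _ _ (fun g x => conj_class phi psi g = conj_class phi psi (x, 0))).
    by move=> g [_ [x gx xP]]; exists x => //; apply: monomial_sum_combos.
  by move=> g g' x -> ->.
have [cover [s_cover coverP]] :=
  monomial_sum_cover (R := R) phi_add P N (r ^ 3) (r ^ 2) P0 ltac:(nia).
pose codes := [seq (c, d) |
  c <- [seq (q, w0) | q <- iota 1 r.*2, w0 <- combos (window (phi := phi) (R := R) q0) r.*2],
  d <- [seq (m, y) | m <- [seq i%:Z - r%:Z | i <- iota 0 r.*2.+1], y <- cover]].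
pose code g (t : (nat * K) * (int * K)) := exists x,
  [/\ conj_class phi psi g = conj_class phi psi (x, t.2.1), (0 < t.1.1)%N,
    x + phiz t.2.1 (iter r phi t.1.2) = iter r phi t.1.2 + iter t.1.1 phi x
    & exists c, x - t.2.2 = iter N (iter_sub (phi := phi) P) c].
have [l2 [sl2 l2P]] : exists l : seq (set (K * int)), size l = size codes /\
    forall g, (A `&` ~` small) g -> conj_class phi psi g \in l.
  apply: (classes_code _ _ code).
    move=> [g m] [/AP[gS card_g] nsmall].
    have [//|] := sphere'_dichotomy phi_add phi_psi psi_phi S_gen _ _ _ gS card_g.
    move=> [q [k [k' [[q_gt0 qq0 qr] [comm gP kP k'P mr]]]]].
    have [x [w0 [xg w0P xP commx]]] := commuting_reduce _ _ _ _ _ _ q_gt0 qr mr comm gP kP k'P.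
    (* The threshold 21 comes from the number of monomials: [16 r^2 + 5 r] is at most [21 r^2],
       hence at most [r^3]. *)
    have /coverP[y yc yP] : monomial_sum (r ^ 3) (r ^ 2) x.
      apply: monomial_sum_le xP; last by rewrite -mulnn; nia.
      have : (21 * (r * r) <= r * (r * r))%N by rewrite leq_mul2r r21 orbT.
      by rewrite !expnS expn0 muln1; nia.
    exists ((q, w0), (m, y)); last by exists x; split.
    apply/allpairsP; exists ((q, w0), (m, y)); split => //.
      apply/allpairsP; exists (q, w0); split => //; first by rewrite mem_iota /=; lia.
      by apply: monomial_sum_combos; apply: monomial_sum_le w0P.
    apply/allpairsP; exists (m, y); split => //.
    have {}mr : `|m| <= r%:Z := mr.
    apply/mapP; exists (absz (m + r%:Z)); last by rewrite gez0_abs /=; lia.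
    by rewrite mem_iota; lia.
  (* Subtracting the two commutation relations shows that [phi^q] fixes [x - x']; the common residue
     [y] puts [x - x'] in the image of the power [N], so [sep] applies. *)
  move=> g g' [[q w0] [m y]] [x [-> /= q_gt0 comm [c xc]]] [x' [-> _ comm' [c' xc']]].
  congr (conj_class _ _ (_, _)); apply/eqP; rewrite -subr_eq0; apply/eqP.
  apply: (sep q _ (c - c') q_gt0).
    rewrite (iter_phiB phi_add).
    by rewrite -[iter q phi x](addKr (iter r phi w0)) -comm
      -[iter q phi x'](addKr (iter r phi w0)) -comm'
      opprD addrACA subrr add0r opprD addrACA subrr addr0.
  by rewrite (iter_iter_subB phi_add) -xc -xc' opprB addrA subrK.
apply: leq_trans (nclasses_le (phi := phi) (psi := psi) A (l1 ++ l2) _) _.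
  move=> g Ag; rewrite mem_cat; have [sg|nsg] := pselect (small g).
    by rewrite l1P.
  by rewrite l2P ?orbT.
have s1 : (size l1 <= r ^ (2 * (q0 * size R)))%N by rewrite sl1 combos_size //; lia.
(* [r^3 (r^2)^N + 1] is at most twice [r^(2N+3)], and one more factor [r] absorbs the 2. *)
have s_cover' : (size cover <= r ^ ((2 * N + 4) * (P * size R * N)))%N.
  apply: leq_trans s_cover _; rewrite [X in (_ <= X)%N]expnM; apply: leq_expW2r.
  rewrite -expnM -expnD; apply: (@leq_trans (r ^ (3 + 2 * N)).*2).
    by rewrite -addnn -addn1 leq_add2l expn_gt0 r0.
  by rewrite -mul2n [(2 * N + 4)%N](_ : _ = (3 + 2 * N).+1) ?expnS ?leq_mul2r; lia.
have s2 : (size l2 <=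
    r ^ (4 + (2 * N + 4) * (P * size R * N) + 2 * (q0 * size R)))%N.
  rewrite sl2 !size_allpairs size_map !size_iota.
  have := combos_size r.*2 (leqnn _); set s := size (combos _ _) => sP.
  have -> : (4 + (2 * N + 4) * (P * size R * N) + 2 * (q0 * size R) =
    (2 + 2 * (q0 * size R)) + (2 + (2 * N + 4) * (P * size R * N)))%N by lia.
  rewrite expnD; apply: leq_mul; rewrite expnD; apply: leq_mul => //.
    by rewrite -mulnn; nia.
  by rewrite -mulnn; nia.
rewrite size_cat.
apply: (@leq_trans (r ^ (4 + (2 * N + 4) * (P * size R * N) + 2 * (q0 * size R))).*2).
  rewrite -addnn; apply: leq_add => //; apply: leq_trans s1 _.
  by apply: leq_pexp2l => //; rewrite leq_addl.
by rewrite -mul2n -[5%N]/(1 + 4)%N -!addnA addnA add1n expnS leq_mul2r; lia.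
Qed.

End Counting.

Theorem theorem4p3 (Rl : realType) (K : zmodType) (phi psi : K -> K)
  (phi_add : {morph phi : x y / x + y})
  (phi_psi : cancel phi psi) (psi_phi : cancel psi phi)
  (R : seq K) (R_sym : forall r, r \in R -> - r \in R)
  (S_gen : forall g : K * int, exists w : seq (K * int),
      (forall s, s \in w -> gens R s) /\ eval_word phi psi w = g)
  (f : nat -> Rl) (f_ge0 : forall r, 0 <= f r)
  (f_infty : forall M : Rl, exists N : nat, forall r : nat, (N <= r)%N -> M <= f r) :
  exists C : Rl, exists r0 : nat, forall r : nat, (r0 <= r)%N ->
    (nclasses phi psi (Fset phi psi R f r))%:R <= (r%:R) `^ (C * f r).
Proof.
have [P [N [P0 sep]]] := periodic_separation phi_add phi_psi psi_phi
  (noetherian_generated phi_add phi_psi R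
    (span_forward_generates phi_add phi_psi psi_phi S_gen)).
have [r1 f_ge1] := f_infty 1.
pose E := (5 + (2 * N + 4) * (P * size R * N))%N.
(* From [r1] on, [f r] is at least 1, so the constant [E] is at most [E * f r]; the other part of
   the exponent uses [q0 <= f r]. *)
exists (E + 2 * size R)%:R, (maxn 21 r1) => r; rewrite geq_max => /andP[r21 /f_ge1 fr1].
pose q0 := Num.truncn (f r).
have /andP[q0_le q0_gt] : q0%:R <= f r < q0.+1%:R by rewrite truncn_itv.
have FP g : Fset phi psi R f r g -> sphere' phi psi R r g /\
    (#|` fset_set (conj_class phi psi g `&` sphere phi psi R r)| <= q0)%N.
  move=> [gS card_g]; split=> //.
  by rewrite -ltnS -(ltr_nat Rl); apply: le_lt_trans q0_gt.
have := nclasses_bound phi_add phi_psi psi_phi R_sym S_gen P N P0 sep r q0 _ r21 FP.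
rewrite -/E -(ler_nat Rl) natrX => /le_trans; apply.
rewrite -powR_mulrn //; apply: ler_powR; first by rewrite ler1n; lia.
rewrite natrD natrD mulrDl lerD //.
  by rewrite ler_peMr.
by rewrite mulnCA natrM mulrC ler_wpM2l.
Qed.
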